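(* Every finite subgroup $G<PSL(2,\mathbb C)$ appears as the isotropy group of a suitable isochronous 1-form: for every finite subgroup $G<PSL(2,\mathbb C)$ there exist an integer $s\ge2$ and $\omega\in\mathcal{RI}\Omega^1(-s)$ such that $PSL(2,\mathbb C)_\omega=G$.
   Context: For $s\ge2$, $\Omega^1(-1^s)$ denotes the set of rational 1-forms on the Riemann sphere $\widehat{\mathbb C}$ having exactly $s$ poles, all simple (zeros are arbitrary). $\mathcal{RI}\Omega^1(-s)\subset\Omega^1(-1^s)$ is the set of isochronous forms, i.e. those all of whose residues are purely imaginary. The group $PSL(2,\mathbb C)$ of Möbius transformations acts on these sets by push-forward $(T,\omega)\mapsto T_*\omega$ (the residue of $T_*\omega$ at $T(p)$ equals the residue of $\omega$ at $p$). The isotropy group of $\omega$ is $PSL(2,\mathbb C)_\omega=\{T\in PSL(2,\mathbb C):T_*\omega=\omega\}$. *)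

(* Defs.v *)
From HB Require Import structures.
From mathcomp Require Import all_boot all_order all_algebra.
From mathcomp Require Import all_classical all_reals.
From mathcomp Require Import complex.

Set Implicit Arguments.
Unset Strict Implicit.
Unset Printing Implicit Defensive.

Import Order.TTheory GRing.Theory Num.Theory.

Local Open Scope classical_set_scope.
Local Open Scope ring_scope.
Local Open Scope complex_scope.
Local Open Scope quotient_scope.

Section PSL2.
Variable R : realType.

Record SL2 : Type := MkSL2 {SL2_mx : 'M[R[i]]_2; _ : \det SL2_mx == 1}.
HB.instance Definition _ := [isSub for SL2_mx].
HB.instance Definition _ := [Choice of SL2 by <:].

Implicit Types A B : SL2.

Lemma SL2_det A : \det (SL2_mx A) = 1.
Proof. by case: A => A /= /eqP. Qed.

Fact SL2_one_subproof : \det (1%:M : 'M[R[i]]_2) == 1.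
Proof. by rewrite det1. Qed.
Fact SL2_mul_subproof A B : \det (SL2_mx A *m SL2_mx B) == 1.
Proof. by rewrite det_mulmx !SL2_det mulr1. Qed.
Fact SL2_inv_subproof A : \det (invmx (SL2_mx A)) == 1.
Proof. by rewrite det_inv SL2_det invr1. Qed.

Definition SL2_one : SL2 := Sub 1%:M SL2_one_subproof.
Definition SL2_mul A B : SL2 :=
  Sub (SL2_mx A *m SL2_mx B) (SL2_mul_subproof A B).
Definition SL2_inv A : SL2 := Sub (invmx (SL2_mx A)) (SL2_inv_subproof A).

Lemma SL2_unit A : SL2_mx A \in unitmx.
Proof. by rewrite unitmxE SL2_det unitr1. Qed.

Definition psl_eqv A B : bool :=
  (SL2_mx A == SL2_mx B) || (SL2_mx A == - SL2_mx B).

Lemma psl_eqv_refl : reflexive psl_eqv.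
Proof. by move=> A; rewrite /psl_eqv eqxx. Qed.
Lemma psl_eqv_sym : symmetric psl_eqv.
Proof.
move=> A B; rewrite /psl_eqv eq_sym; congr (_ || _).
by rewrite eq_sym eqr_oppLR.
Qed.
Lemma psl_eqv_trans : transitive psl_eqv.
Proof.
move=> B A C /orP[] /eqP AB /orP[] /eqP BC;
rewrite /psl_eqv AB BC ?opprK eqxx //;
by rewrite orbT.
Qed.
Canonical psl_eqv_equiv :=
  EquivRel psl_eqv psl_eqv_refl psl_eqv_sym psl_eqv_trans.

Definition PSL2 : Type := {eq_quot psl_eqv}.
HB.instance Definition _ : EqQuotient _ psl_eqv PSL2 := EqQuotient.on PSL2.
HB.instance Definition _ := Choice.on PSL2.

Definition PSL2_one : PSL2 := \pi_PSL2 SL2_one.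
Definition PSL2_mul := lift_op2 PSL2 SL2_mul.
Definition PSL2_inv := lift_op1 PSL2 SL2_inv.

Lemma repr_psl A :
  SL2_mx (repr (\pi_PSL2 A)) = SL2_mx A \/
  SL2_mx (repr (\pi_PSL2 A)) = - SL2_mx A.
Proof.
have /eqmodP/orP[/eqP|/eqP] : repr (\pi_PSL2 A) = A %[mod PSL2]
  by rewrite reprK.
  by left.
by right.
Qed.

Lemma pi_PSL2_mul : {morph \pi_PSL2 : A B / SL2_mul A B >-> PSL2_mul A B}.
Proof.
move=> A B; unlock PSL2_mul; apply/eqmodP; rewrite /= /psl_eqv /=.
by case: (repr_psl A) => ->; case: (repr_psl B) => ->;
  rewrite ?mulNmx ?mulmxN ?opprK eqxx ?orbT.
Qed.

Lemma pi_PSL2_inv : {morph \pi_PSL2 : A / SL2_inv A >-> PSL2_inv A}.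
Proof.
move=> A; unlock PSL2_inv; apply/eqmodP; rewrite /= /psl_eqv /=.
case: (repr_psl A) => ->; first by rewrite eqxx.
rewrite -[- SL2_mx A]scaleN1r invmxZ.
  by rewrite invrN1 scaleN1r opprK eqxx orbT.
rewrite scaleN1r unitmxE -scaleN1r detZ unitrM.
by rewrite SL2_det unitr1 unitrX ?unitrN1.
Qed.

Lemma PSL2_mulA : associative PSL2_mul.
Proof.
elim/quotW=> A; elim/quotW=> B; elim/quotW=> C; rewrite -!pi_PSL2_mul.
by congr (\pi_PSL2 _); apply: val_inj; rewrite /= mulmxA.
Qed.
Lemma PSL2_mul1l : left_id PSL2_one PSL2_mul.
Proof.
elim/quotW=> A; rewrite -pi_PSL2_mul.
by congr (\pi_PSL2 _); apply: val_inj; rewrite /= mul1mx.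
Qed.
Lemma PSL2_mul1r : right_id PSL2_one PSL2_mul.
Proof.
elim/quotW=> A; rewrite -pi_PSL2_mul.
by congr (\pi_PSL2 _); apply: val_inj; rewrite /= mulmx1.
Qed.
Lemma PSL2_mulVl : left_inverse PSL2_one PSL2_inv PSL2_mul.
Proof.
elim/quotW=> A; rewrite -pi_PSL2_inv -pi_PSL2_mul.
by congr (\pi_PSL2 _); apply: val_inj; rewrite /= mulVmx ?SL2_unit.
Qed.
Lemma PSL2_mulVr : right_inverse PSL2_one PSL2_inv PSL2_mul.
Proof.
elim/quotW=> A; rewrite -pi_PSL2_inv -pi_PSL2_mul.
by congr (\pi_PSL2 _); apply: val_inj; rewrite /= mulmxV ?SL2_unit.
Qed.

HB.instance Definition _ := isGroup.Build PSL2
  PSL2_mulA PSL2_mul1l PSL2_mul1r PSL2_mulVl PSL2_mulVr.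

End PSL2.

Section RationalForms.
Variable R : realType.
Local Notation C := (R[i]).
Local Notation ratfun := {fraction {poly C}}.
Local Notation "p %:F" := (@FracField.tofrac {poly C} p).

(* The rational function [f] stands for the rational 1-form [f dz], where [z] is
   the affine coordinate of the Riemann sphere. *)
Definition ratform : Type := ratfun.

(* [Some a] is the finite point [a], [None] the point at infinity. *)
Definition sphere : Type := option C.

Implicit Types (f g phi : ratfun) (w : ratform) (p : sphere).

(* Only meaningful when the denominator of [f] does not vanish at [phi], in
   particular whenever [phi] is not constant. *)
Definition comp_ratfun f phi : ratfun :=
  let at_phi (q : {poly C}) := (map_poly (fun c => c%:P%:F) q).[phi] in
  at_phi (\n_(repr f)) / at_phi (\d_(repr f)).

Definition deriv_ratfun f : ratfun :=
  let n := \n_(repr f) in let d := \d_(repr f) in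
  (n^`() * d - n * d^`())%:F / (d ^+ 2)%:F.

Definition pullback phi w : ratform := comp_ratfun w phi * deriv_ratfun phi.

Definition moebius (A : 'M[C]_2) : ratfun :=
  (A 0 0 *: 'X + (A 0 1)%:P)%:F / (A 1 0 *: 'X + (A 1 1)%:P)%:F.

(* [T_* w] is the pull-back of [w] by [T^-1]; it does not depend on the matrix
   chosen to represent [T^-1], see [pushforward_pi]. *)
Definition pushforward (T : PSL2 R) w : ratform :=
  pullback (moebius (SL2_mx (repr (T^-1)%g))) w.

Lemma moebiusN (A : 'M[C]_2) : moebius (- A) = moebius A.
Proof.
by rewrite /moebius !mxE !scaleNr !polyCN -!opprD !rmorphN /= invrN mulrNN.
Qed.

Lemma pushforward_pi (A : SL2 R) w :
  pushforward (\pi_(PSL2 R) A) w = pullback (moebius (invmx (SL2_mx A))) w.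
Proof.
rewrite /pushforward; congr pullback.
have -> : ((\pi_(PSL2 R) A)^-1)%g = \pi_(PSL2 R) (SL2_inv A).
  by rewrite pi_PSL2_inv.
by case: (repr_psl (SL2_inv A)) => ->; rewrite ?moebiusN.
Qed.

Definition isotropy w : set (PSL2 R) := [set T | pushforward T w = w].

(* The inverse of a local coordinate centred at [p]: [t |-> a + t] at a finite
   point [a], and [t |-> 1/t] at infinity. *)
Definition chart p : ratfun :=
  if p is Some a then ('X + a%:P)%:F else ('X%:F)^-1.

(* The coefficient [h] of [w = h(t) dt] in the local coordinate [t] at [p]. *)
Definition local_coef w p : ratfun := pullback (chart p) w.

Definition has_order w p (n : int) : Prop :=
  exists u v : {poly C}, [/\ u.[0] != 0, v.[0] != 0 &
    local_coef w p = u%:F / v%:F * 'X%:F ^ n].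

Definition poles w : set sphere :=
  [set p | exists2 n : int, n < 0 & has_order w p n].

(* [r] is the coefficient of [1/t] in the Laurent expansion of [w] at [p],
   written as its principal part plus a function regular at [t = 0]. *)
Definition is_residue w p (r : C) : Prop :=
  exists (m : nat) (c : nat -> C) (u v : {poly C}),
    [/\ v.[0] != 0,
        local_coef w p =
          u%:F / v%:F + \sum_(k < m.+1) (c k)%:P%:F / 'X%:F ^+ k.+1 &
        r = c 0%N].

Definition simple_pole_forms (s : nat) : set ratform :=
  [set w | (poles w #= `I_s)%card /\ forall p, poles w p -> has_order w p (-1)].

Definition isochronous_forms (s : nat) : set ratform :=
  [set w | simple_pole_forms s w /\
           forall p r, is_residue w p r -> complex.Re r = 0].

End RationalForms.

(* Main.v *)
Require Import Defs.
From mathcomp Require Import finmap.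
From mathcomp Require Import all_boot all_order all_algebra.
From mathcomp Require Import all_classical all_reals.
From mathcomp Require Import complex.
From mathcomp Require Import ring.

Set Implicit Arguments.
Unset Strict Implicit.
Unset Printing Implicit Defensive.

Import Order.TTheory GRing.Theory Num.Theory.

Local Open Scope classical_set_scope.
Local Open Scope ring_scope.
Local Open Scope complex_scope.
Local Open Scope quotient_scope.

(** A form with simple poles on the sphere is determined by its poles and their
    residues, so a Moebius map fixes it exactly when it permutes the poles and
    preserves the residues.  Realizing [G] as an isotropy group thus amounts to
    finding a [G]-invariant finite set of weighted points, of total weight 0,
    with no further symmetry.

    The points are the [G]-orbits of four base points [z0, z1, z2, z3], and the
    orbit of each base point carries its own residue: [i], [2i], [3i], [-6i].
    These residues are purely imaginary and pairwise distinct and add up to 0.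
    The base points are chosen generically ([exists_rigid_points]): their orbits
    avoid infinity, are regular and are pairwise disjoint.  Invariance under [G]
    is then a reindexing of the orbits ([orbit_form_invariant]).

    Conversely, a [T] fixing the form preserves each orbit, hence for each [j]
    sends some [g_j zj], with [g_j] in [G], to [zj] ([orbit_form_stabilizer]).
    A Moebius map is determined by its values at three points, so for [j < 3]
    this leaves finitely many candidates [T], at most one for each choice of
    [g_0, g_1, g_2].  If [T] is not in [G], then [T g_3] is not the identity,
    so it has at most two fixed points; choosing [z3] outside this finite
    collection of fixed points rules such a [T] out.

    The computational input is the push-forward of a sum of simple poles
    ([pushforward_simple_form]).  Substituting [phi] in [r dz / (z - p)] gives
    [r] times the logarithmic derivative of [phi - p], which is a pole at the
    preimage of [p] minus a pole at the preimage of infinity; as the residues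
    add up to 0, the latter cancel. *)

Local Notation "p %:F" := (FracField.tofrac p).

(** * Substitution and derivation in the field of rational functions *)

Lemma frac_numden (K : idomainType) (f : {fraction K}) :
  f = (\n_(repr f))%:F / (\d_(repr f))%:F.
Proof.
have d0 : (\d_(repr f))%:F != 0 :> {fraction K}.
  by rewrite tofrac_eq0 denom_ratioP.
apply: (canRL (mulfK d0)).
transitivity (\pi_{fraction K} (repr f) * (\d_(repr f))%:F); first by rewrite reprK.
move: (repr f) => x; unlock FracField.tofrac; rewrite -[LHS]FracField.pi_mul.
apply/eqmodP; rewrite /= FracField.equivfE /FracField.mulf.
by rewrite !numden_Ratio ?mulf_neq0 ?oner_neq0 ?denom_ratioP // !mulr1 mulrC.
Qed.

Section Substitution.
Variable R : realType.
Local Notation C := (R[i]).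
Local Notation ratfun := {fraction {poly C}}.
Implicit Types (f g phi : ratfun) (u v q : {poly C}).

Let cst : {rmorphism C -> ratfun} := (@FracField.tofrac {poly C}) \o polyC.

Definition subst phi q : ratfun := (map_poly cst q).[phi].

Lemma substM phi : {morph subst phi : u v / u * v}.
Proof. by move=> u v; rewrite /subst rmorphM hornerM. Qed.
Lemma substD phi : {morph subst phi : u v / u + v}.
Proof. by move=> u v; rewrite /subst rmorphD hornerD. Qed.
Lemma substC phi c : subst phi c%:P = c%:P%:F.
Proof. by rewrite /subst map_polyC hornerC. Qed.
Lemma subst_subXC phi c : subst phi ('X - c%:P) = phi - c%:P%:F.
Proof. by rewrite /subst rmorphB /= map_polyX map_polyC !hornerE. Qed.

Definition nonconstant phi := forall c : C, phi != c%:P%:F.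

(** Over an algebraically closed field [q] is a product of factors [X - a], and
    each of them becomes [phi - a], which is nonzero as [phi] is not [a]. *)
Lemma subst_neq0 phi q : nonconstant phi -> q != 0 -> subst phi q != 0.
Proof.
move=> ncst q0; have [r ->] := closed_field_poly_normal q.
rewrite -mul_polyC substM substC mulf_neq0 ?tofrac_eq0 ?polyC_eq0 ?lead_coef_eq0 //.
elim: r => [|a r IH]; first by rewrite big_nil -[1]/(1%:P) substC tofrac_eq0 oner_neq0.
rewrite big_cons substM; apply: mulf_neq0; last exact: IH.
rewrite subst_subXC subr_eq0; exact: ncst.
Qed.

(** As [subst phi] kills no denominator, it extends to fractions; in particular
    the choice of a representative of [u / v] does not matter. *)
Lemma comp_ratfunE phi u v : nonconstant phi -> v != 0 ->
  comp_ratfun (u%:F / v%:F) phi = subst phi u / subst phi v.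
Proof.
move=> ncst v0; set f := _ / _.
change (subst phi (\n_(repr f)) / subst phi (\d_(repr f)) = subst phi u / subst phi v).
have d0 : \d_(repr f) != 0 by rewrite denom_ratioP.
apply/eqP; rewrite eqr_div ?subst_neq0 // -!substM; apply/eqP; congr subst.
apply/eqP; rewrite -tofrac_eq !tofracM -eqr_div ?tofrac_eq0 //.
by rewrite -frac_numden.
Qed.

Lemma comp_ratfunD phi f g : nonconstant phi ->
  comp_ratfun (f + g) phi = comp_ratfun f phi + comp_ratfun g phi.
Proof.
move=> ncst; rewrite [f]frac_numden [g]frac_numden.
have := denom_ratioP (repr f); have := denom_ratioP (repr g).
move: (\n_(repr f)) (\d_(repr f)) (\n_(repr g)) (\d_(repr g)) => a b c d d0 b0.
rewrite addf_div ?tofrac_eq0 // -!tofracM -tofracD !comp_ratfunE ?mulf_neq0 //.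
by rewrite substD !substM addf_div ?subst_neq0.
Qed.

Lemma comp_ratfun0 phi : nonconstant phi -> comp_ratfun 0 phi = 0.
Proof.
move=> ncst; have := comp_ratfunD 0 0 ncst; rewrite addr0.
by rewrite -[LHS]addr0 => /addrI.
Qed.

Lemma comp_ratfun_pole phi c p : nonconstant phi ->
  comp_ratfun (c%:P%:F / ('X - p%:P)%:F) phi = c%:P%:F / (phi - p%:P%:F).
Proof.
by move=> ncst; rewrite comp_ratfunE ?polyXsubC_eq0 // substC subst_subXC.
Qed.

(** If [a / b] is another way to write [u / v], differentiating [u * b = a * v]
    shows that the quotient rule gives the same result for both. *)
Lemma deriv_ratfunE u v : v != 0 ->
  deriv_ratfun (u%:F / v%:F) = (u^`() * v - u * v^`())%:F / (v ^+ 2)%:F.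
Proof.
move=> v0; rewrite /deriv_ratfun; set f := u%:F / v%:F.
have := frac_numden f; have := denom_ratioP (repr f).
move: (\n_(repr f)) (\d_(repr f)) => a b b0 /eqP; rewrite /f {f}.
rewrite eqr_div ?tofrac_eq0 // -!tofracM tofrac_eq => /eqP ub.
have := congr1 deriv ub; rewrite !derivM => dub.
apply/eqP; rewrite eqr_div ?tofrac_eq0 ?expf_neq0 // -!tofracM tofrac_eq; apply/eqP.
have -> : (a^`() * b - a * b^`()) * v ^+ 2 =
  (a^`() * v + a * v^`()) * b * v - a * v * (b * v^`() + v * b^`()) by ring.
by rewrite -dub -ub; ring.
Qed.

End Substitution.

(** * Pull-back of a simple pole by a Moebius map *)

(** With [phi = A / D], where [a] and [c] are the derivatives of [A] and [D],
    both sides are [r] times the logarithmic derivative of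
    [phi - p = (A - p * D) / D]. *)
Lemma dlog_identity (K : fieldType) (A D r p a c : K) :
  D != 0 -> A - p * D != 0 ->
  r / (A / D - p) * ((a * D - A * c) / (D * D)) =
  r * ((a - p * c) / (A - p * D) - c / D).
Proof. by move=> d0 n0; field; rewrite n0 d0. Qed.

Section Moebius.
Variable R : realType.
Local Notation C := (R[i]).
Local Notation ratfun := {fraction {poly C}}.
Implicit Types (a b c d : C) (L : seq (C * C)).

Definition lin a b : {poly C} := a *: 'X + b%:P.

Lemma lin_eq0 a b : (lin a b == 0) = (a == 0) && (b == 0).
Proof.
apply/eqP/andP => [ab0|[/eqP-> /eqP->]]; last by rewrite /lin scale0r addr0.
have := congr1 (coefp 0) ab0; have := congr1 (coefp 1) ab0.
by rewrite /= !coefE /= mulr0 mulr1 add0r addr0 => -> ->.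
Qed.

Lemma linB a b c d e : lin a b - e%:P * lin c d = lin (a - e * c) (b - e * d).
Proof. by rewrite /lin !rmorphB !rmorphM /= -!mul_polyC; ring. Qed.

Lemma horner_lin a b z : (lin a b).[z] = a * z + b.
Proof. by rewrite /lin hornerD hornerZ hornerX hornerC. Qed.

Lemma deriv_lin a b : (lin a b)^`() = a%:P.
Proof. by rewrite /lin !derivE alg_polyC addr0. Qed.

Lemma lin_neq0l a b c d : a * d - b * c != 0 -> lin a b != 0.
Proof.
by apply: contra_neq => /eqP; rewrite lin_eq0 => /andP[/eqP-> /eqP->]; ring.
Qed.

Lemma lin_neq0r a b c d : a * d - b * c != 0 -> lin c d != 0.
Proof.
by apply: contra_neq => /eqP; rewrite lin_eq0 => /andP[/eqP-> /eqP->]; ring.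
Qed.

Lemma nonconstant_lin a b c d : a * d - b * c != 0 ->
  nonconstant ((lin a b)%:F / (lin c d)%:F).
Proof.
move=> nz e; apply: contra_neq (nz).
have d0 := lin_neq0r nz.
move=> /(canRL (mulfVK _)); rewrite tofrac_eq0 d0 -tofracM => /(_ isT) /eqP.
rewrite tofrac_eq -subr_eq0 linB lin_eq0 !subr_eq0 => /andP[/eqP-> /eqP->].
by ring.
Qed.

(** The first fraction is a pole at the preimage of [p]; it vanishes when
    [a - p * c = 0], that is when this preimage is infinity.  The second one is
    a pole at the preimage of infinity, and is the same for all [p]. *)
Lemma pullback_pole a b c d r p : a * d - b * c != 0 ->
  pullback ((lin a b)%:F / (lin c d)%:F) (r%:P%:F / ('X - p%:P)%:F) =
  r%:P%:F * ((a - p * c)%:P%:F / (lin (a - p * c) (b - p * d))%:F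
             - c%:P%:F / (lin c d)%:F).
Proof.
move=> nz; rewrite /pullback comp_ratfun_pole; last exact: nonconstant_lin.
rewrite deriv_ratfunE; last exact: lin_neq0r nz.
have n0 : (lin (a - p * c) (b - p * d))%:F != 0 :> ratfun.
  rewrite tofrac_eq0; apply: (@lin_neq0l _ _ c d); apply: contra_neq (nz) => <-.
  by ring.
have d0 : (lin c d)%:F != 0 :> ratfun by rewrite tofrac_eq0 (lin_neq0r nz).
rewrite !deriv_lin -linB in n0 *; rewrite rmorphB rmorphM.
move: n0; rewrite !(tofracB, tofracM, tofracXn, rmorphB, rmorphM) /=.
move: (a%:P%:F) (c%:P%:F) (p%:P%:F) (r%:P%:F) (lin a b)%:F (lin c d)%:F d0.
move=> a' c' p' r' A D d0 n0.
exact (dlog_identity r' a' c' d0 n0).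
Qed.
End Moebius.

(** * Poles and residues in a local coordinate *)

Lemma polar_identity (K : fieldType) (r u v x : K) : x != 0 -> v != 0 ->
  r / x + u / v = (r * v + u * x) / v / x.
Proof. by move=> x0 v0; field; rewrite x0 v0. Qed.

Section LocalTheory.
Variable R : realType.
Local Notation C := (R[i]).
Local Notation ratfun := {fraction {poly C}}.
Implicit Types (f g phi : ratfun) (u v : {poly C}) (r z : C) (p : C * C).
Implicit Types (L : seq (C * C)).

(** The local ring at 0. *)
Definition regular f := exists u v, v.[0] != 0 /\ f = u%:F / v%:F.

Lemma horner_neq0 v r : v.[r] != 0 -> v != 0.
Proof. by apply: contra_neq => ->; rewrite horner0. Qed.

Lemma regular_frac u v : v.[0] != 0 -> regular (u%:F / v%:F).
Proof. by exists u, v. Qed.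

Lemma regular0 : regular 0.
Proof. by exists 0, 1; rewrite hornerC oner_neq0 mul0r. Qed.

Lemma regularD f g : regular f -> regular g -> regular (f + g).
Proof.
move=> [u [v [v0 ->]]] [u' [v' [v'0 ->]]].
have [nv nv'] := (horner_neq0 v0, horner_neq0 v'0).
rewrite addf_div ?tofrac_eq0 // -!tofracM -tofracD; apply: regular_frac.
by rewrite hornerM mulf_neq0.
Qed.

Lemma regularN f : regular f -> regular (- f).
Proof.
move=> [u [v [v0 ->]]]; exists (- u), v; split=> //.
by rewrite rmorphN mulNr.
Qed.

(** After multiplication by ['X^m.+1] the sum becomes a polynomial [P] of degree
    at most [m].  If the sum is [u / v] with [v.[0] != 0], then ['X^m.+1]
    divides [v * P] and is prime to [v], so it divides [P] and [P = 0]. *)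
Lemma regular_residue_eq0 m (e : nat -> C) :
  regular (\sum_(k < m.+1) (e k)%:P%:F / 'X%:F ^+ k.+1) -> e 0%N = 0.
Proof.
move=> [u [v [v0 eq_uv]]]; have nv := horner_neq0 v0.
pose P : {poly C} := \sum_(k < m.+1) e k *: 'X^(m - k).
have nX : 'X%:F != 0 :> ratfun by rewrite tofrac_eq0 polyX_eq0.
have PE : P%:F = (\sum_(k < m.+1) (e k)%:P%:F / 'X%:F ^+ k.+1) * 'X%:F ^+ m.+1.
  rewrite mulr_suml rmorph_sum; apply: eq_bigr => -[k lt_km] _ /=.
  rewrite -mul_polyC tofracM tofracXn -mulrA; congr (_ * _).
  have -> : m.+1 = (k.+1 + (m - k))%N by rewrite addSn subnKC.
  by rewrite exprD mulKf ?expf_neq0.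
have sizeP : (size P <= m.+1)%N.
  apply: (leq_trans (size_sum _ _ _)); apply/bigmax_leqP => k _.
  by rewrite (leq_trans (size_scale_leq _ _)) // size_polyXn ltnS leq_subr.
have vP : v * P = 'X^(m.+1) * u.
  apply/eqP; rewrite -tofrac_eq !tofracM PE eq_uv tofracXn; apply/eqP.
  rewrite mulrA [_ * (_ / _)]mulrC divfK ?tofrac_eq0 //; exact: mulrC.
have P0 : P = 0.
  apply: contraTeq sizeP => nP; rewrite -ltnNge -(size_polyXn C m.+1).
  apply: (dvdp_leq nP).
  have cop : coprimep 'X^(m.+1) v.
    by rewrite coprimep_pexpl // coprimep_sym coprimepX rootE.
  by rewrite -(Gauss_dvdpr _ cop) vP dvdp_mulr.
have := congr1 (coefp m) P0; rewrite /= coef0 coef_sum (bigD1 ord0) //= subn0.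
rewrite coefZ coefXn eqxx mulr1 big1 ?addr0 // => k k0.
rewrite coefZ coefXn gtn_eqF ?mulr0 //.
have k_gt0 : (0 < k)%N by rewrite lt0n; apply: contra k0 => /eqP kE; apply/eqP/val_inj.
by rewrite ltn_subrL k_gt0 /= (leq_trans k_gt0) // -ltnS.
Qed.

(** At most a simple pole: [r = 0] is allowed, and then [f] is regular. *)
Definition simple_pole_with r f := exists2 g, regular g & f = r%:P%:F / 'X%:F + g.

Lemma simple_pole_with0 : simple_pole_with 0 0.
Proof. by exists 0; [apply: regular0|rewrite mul0r addr0]. Qed.

Lemma simple_pole_withD r s f g : simple_pole_with r f ->
  simple_pole_with s g -> simple_pole_with (r + s) (f + g).
Proof.
move=> [f' f'R ->] [g' g'R ->]; exists (f' + g'); first exact: regularD.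
by rewrite !rmorphD mulrDl /= addrACA.
Qed.

Lemma simple_pole_with_uniq r r' f :
  simple_pole_with r f -> simple_pole_with r' f -> r = r'.
Proof.
move=> [g gR ->] [h hR] /eqP; rewrite -subr_eq0 => /eqP E.
apply/eqP; rewrite -subr_eq0; apply/eqP.
apply: (@regular_residue_eq0 0 (fun=> r - r')); rewrite big_ord1 expr1.
have -> : (r - r')%:P%:F / 'X%:F = h - g :> ratfun.
  rewrite !(rmorphB, mulrBl) /=.
  by apply/eqP; rewrite -subr_eq0 -E; apply/eqP; ring.
by apply: regularD; last apply: regularN.
Qed.

(** The expansion in the hypothesis may contain spurious terms of higher order;
    the difference of the two polar parts is regular, hence has residue 0. *)
Lemma residue_simple_pole r m (c : nat -> C) u v f :
    v.[0] != 0 -> simple_pole_with r f ->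
    f = u%:F / v%:F + \sum_(k < m.+1) (c k)%:P%:F / 'X%:F ^+ k.+1 ->
  c 0%N = r.
Proof.
move=> v0 [g gR ->] E; apply/eqP; rewrite -subr_eq0; apply/eqP.
pose e k := c k - (k == 0)%N%:R * r.
have -> : c 0%N - r = e 0%N by rewrite /e mul1r.
apply: (@regular_residue_eq0 m).
have -> : \sum_(k < m.+1) (e k)%:P%:F / 'X%:F ^+ k.+1 = g - u%:F / v%:F.
  have -> : g - u%:F / v%:F =
      \sum_(k < m.+1) (c k)%:P%:F / 'X%:F ^+ k.+1 - r%:P%:F / 'X%:F.
    by apply: (canRL (addrK _)); rewrite addrC addrA; apply: (canLR (addrK _));
      rewrite E addrC.
  rewrite !big_ord_recl /= expr1 addrAC -mulrBl /e /= mul1r !rmorphB /=.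
  congr (_ + _); apply: eq_bigr => k _; rewrite mul0r subr0 //.
by apply: regularD => //; apply: regularN; apply: regular_frac.
Qed.

(** If [n] were negative, clearing denominators would give an equality of
    polynomials whose left-hand side vanishes at 0 and whose right-hand side
    does not. *)
Lemma regular_order_ge0 f u v (n : int) : regular f ->
  u.[0] != 0 -> v.[0] != 0 -> f = u%:F / v%:F * 'X%:F ^ n -> 0 <= n.
Proof.
move=> [u' [v' [v'0 ->]]] u0 v0; case: n => // k E; exfalso.
have [nv nv'] := (horner_neq0 v0, horner_neq0 v'0).
have nX : 'X%:F ^+ k.+1 != 0 :> ratfun by rewrite expf_neq0 // tofrac_eq0 polyX_eq0.
have : u' * (v * 'X^(k.+1)) = u * v'.
  have nvX : (v * 'X^(k.+1))%:F != 0 :> ratfun.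
    rewrite tofracM tofracXn; apply: mulf_neq0 nX.
    by rewrite tofrac_eq0; exact: nv.
  apply/eqP; rewrite -tofrac_eq tofracM [X in _ == X]tofracM.
  rewrite -(eqr_div _ _ _ nvX); last by rewrite tofrac_eq0; exact: nv'.
  by rewrite E NegzE -exprnN tofracM tofracXn invfM mulrA.
move/(congr1 (horner_eval 0)); rewrite /= /horner_eval !hornerM hornerXn expr0n.
by rewrite !mulr0 => /esym/eqP; rewrite mulf_eq0 (negPf u0) (negPf v'0).
Qed.

Lemma simple_pole_order r f : r != 0 -> simple_pole_with r f ->
  exists u v, [/\ u.[0] != 0, v.[0] != 0 & f = u%:F / v%:F * 'X%:F ^ (-1)].
Proof.
move=> r0 [_ [u [v [v0 ->]]] ->]; have nv := horner_neq0 v0.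
have nX : 'X%:F != 0 :> ratfun by rewrite tofrac_eq0 polyX_eq0.
exists (r%:P * v + u * 'X), v; split => //.
  by rewrite hornerD !hornerM hornerX hornerC mulr0 addr0 mulf_neq0.
rewrite exprN1 tofracD !tofracM.
have nv' : v%:F != 0 :> ratfun by rewrite tofrac_eq0; exact: nv.
exact (polar_identity _ _ nX nv').
Qed.

(** The pair [p] consists of the position of the pole and its residue. *)
Definition pole p : ratfun := p.2%:P%:F / ('X - p.1%:P)%:F.
Definition simple_form (L : seq (C * C)) : ratform R := \sum_(p <- L) pole p.

Lemma pullback_simple_form phi L : nonconstant phi ->
  pullback phi (simple_form L) = \sum_(p <- L) pullback phi (pole p).
Proof.
move=> ncst; elim: L => [|p L IH].
  by rewrite /simple_form !big_nil /pullback comp_ratfun0 // mul0r.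
rewrite /simple_form !big_cons -IH /pullback -mulrDl; congr (_ * _).
exact: comp_ratfunD.
Qed.

Lemma lin10 : lin 1 0 = 'X :> {poly C}.
Proof. by rewrite /lin scale1r addr0. Qed.

(** Both kinds of charts are Moebius maps, so that [pullback_pole] computes
    local coefficients too.  The chart at infinity has determinant -1. *)
Lemma chart_lin (q : sphere R) : exists a b c d : C,
  [/\ a * d - b * c != 0, chart q = (lin a b)%:F / (lin c d)%:F &
      if q is Some z then [/\ a = 1, b = z, c = 0 & d = 1]
      else [/\ a = 0, b = 1, c = 1 & d = 0]].
Proof.
case: q => [z|]; [exists 1, z, 0, 1|exists 0, 1, 1, 0]; split=> //.
- by rewrite mulr1 mulr0 subr0 oner_neq0.
- by rewrite /lin scale1r scale0r add0r invr1 mulr1.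
- by rewrite mulr0 mulr1 add0r oppr_eq0 oner_neq0.
- by rewrite lin10 /lin scale0r add0r mul1r.
Qed.

Lemma local_pole_finite p z :
  simple_pole_with (if p.1 == z then p.2 else 0) (local_coef (pole p) (Some z)).
Proof.
have [a [b [c [d [nz chartE [aE bE cE dE]]]]]] := chart_lin (Some z).
rewrite /local_coef chartE pullback_pole // aE bE cE dE.
rewrite !mulr0 !mulr1 subr0 mul0r subr0.
case: eqP => [->|/eqP p_z]; rewrite ?subrr.
  by exists 0; [apply: regular0|rewrite lin10 addr0 polyC1 tofrac1 mul1r].
exists (p.2%:P%:F * (1%:P%:F / (lin 1 (z - p.1))%:F)); last by rewrite mul0r add0r.
rewrite mulrA -tofracM; apply: regular_frac.
by rewrite /lin !hornerE subr_eq0 eq_sym.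
Qed.

(** In the coordinate [t = 1 / z], the form [r dz / (z - p)] is
    [- r dt / (t * (1 - p * t))]: its residue at infinity is [- r]. *)
Lemma local_pole_infinite p :
  simple_pole_with (- p.2) (local_coef (pole p) None).
Proof.
have [a [b [c [d [nz chartE [aE bE cE dE]]]]]] := chart_lin None.
rewrite /local_coef chartE pullback_pole // aE bE cE dE.
rewrite !mulr0 !mulr1 subr0 sub0r lin10 mulrBr.
exists (p.2%:P%:F * ((- p.1)%:P%:F / (lin (- p.1) 1)%:F)).
  rewrite mulrA -tofracM; apply: regular_frac.
  by rewrite /lin !hornerE oner_neq0.
rewrite addrC; congr (_ + _); rewrite rmorphN rmorphN -mulNr; congr (_ * _).
by rewrite polyC1 tofrac1 div1r.
Qed.

(** The same position may occur several times in [L]. *)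
Definition residue_at L z : C := \sum_(p <- L | p.1 == z) p.2.

Lemma nonconstant_chart (q : sphere R) : nonconstant (chart q).
Proof.
have [a [b [c [d [nz -> _]]]]] := chart_lin q; exact: nonconstant_lin.
Qed.

Lemma local_form_finite L z :
  simple_pole_with (residue_at L z) (local_coef (simple_form L) (Some z)).
Proof.
rewrite /local_coef pullback_simple_form; last exact: nonconstant_chart.
rewrite /residue_at; elim: L => [|p L IH].
  by rewrite !big_nil; apply: simple_pole_with0.
rewrite !big_cons; have := simple_pole_withD (local_pole_finite p z) IH.
by case: ifP => // _; rewrite add0r.
Qed.

Lemma local_form_infinite L :
  simple_pole_with (- \sum_(p <- L) p.2) (local_coef (simple_form L) None).
Proof.
rewrite /local_coef pullback_simple_form; last exact: nonconstant_chart.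
elim: L => [|p L IH].
  by rewrite !big_nil oppr0; apply: simple_pole_with0.
rewrite !big_cons opprD.
by apply: simple_pole_withD => //; apply: local_pole_infinite.
Qed.

End LocalTheory.

(** * Forms with prescribed simple poles and residues *)

Section SimpleForms.
Variable R : realType.
Local Notation C := (R[i]).
Implicit Types (z : C) (p : C * C) (L : seq (C * C)).

Lemma residue_at_out L z : z \notin unzip1 L -> residue_at L z = 0.
Proof.
move=> zL; rewrite /residue_at big_seq_cond big1 // => p /andP[pL /eqP pz].
by case/negP: zL; rewrite -pz map_f.
Qed.

Lemma residue_at_in L p : uniq (unzip1 L) -> p \in L -> residue_at L p.1 = p.2.
Proof.
rewrite /residue_at; elim: L => // q L IH /= /andP[qL uL].
rewrite inE big_cons => /predU1P[->|pL].
  by rewrite eqxx [X in _ + X](residue_at_out qL) addr0.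
rewrite ifN ?IH //; apply: contra qL => /eqP->; exact: map_f.
Qed.

(** Infinity is at most a simple pole, with residue minus the sum of the others:
    when this sum is 0, the form is regular there. *)
Lemma polesE L : uniq (unzip1 L) -> all (fun p => p.2 != 0) L ->
  \sum_(p <- L) p.2 = 0 -> poles (simple_form L) = [set` map Some (unzip1 L)].
Proof.
move=> uL /allP L0 sumL; apply/seteqP; split=> [q|q] /=.
  move=> [n n_lt0 [u [v [u0 v0 E]]]].
  have reg : ~ regular (local_coef (simple_form L) q).
    by move=> h; have := regular_order_ge0 h u0 v0 E; rewrite leNgt n_lt0.
  case: q E reg => [z|] E reg; last first.
    exfalso; apply: reg; have := local_form_infinite L; rewrite sumL oppr0.
    by move=> [g gR ->]; rewrite mul0r add0r.
  case: (boolP (z \in unzip1 L)) => [zL|zL]; first by rewrite map_f.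
  exfalso; apply: reg; have := local_form_finite L z.
  by rewrite residue_at_out // => -[g gR ->]; rewrite mul0r add0r.
move=> /mapP[_ /mapP[p pL ->] ->]; exists (-1) => //.
have := local_form_finite L p.1; rewrite residue_at_in //.
by apply: simple_pole_order; apply: L0.
Qed.

Lemma simple_form_isochronous L : uniq (unzip1 L) ->
    all (fun p => p.2 != 0) L -> \sum_(p <- L) p.2 = 0 ->
    all (fun p => complex.Re p.2 == 0) L ->
  isochronous_forms (size L) (simple_form L).
Proof.
move=> uL L0 sumL /allP imL; split; last first.
  move=> q r [m [c [u [v [v0 E ->]]]]]; case: q E => [z|] E.
    rewrite (residue_simple_pole v0 (local_form_finite L z) E).
    case: (boolP (z \in unzip1 L)) => [/mapP[p pL ->]|zL].
      by rewrite residue_at_in //; apply/eqP/imL.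
    by rewrite residue_at_out.
  by rewrite (residue_simple_pole v0 (local_form_infinite L) E) sumL oppr0.
split; rewrite polesE //.
  have -> : [set` map Some (unzip1 L)] = [set` [fset x in map Some (unzip1 L)]%fset].
    by apply/seteqP; split => x /=; rewrite !inE.
  apply/card_eq_fsetP; rewrite card_fseq undup_id; first by rewrite !size_map.
  by rewrite map_inj_uniq // => ? ? [].
move=> q /= /mapP[_ /mapP[p pL ->] ->].
have := local_form_finite L p.1; rewrite residue_at_in //.
by apply: simple_pole_order; apply: (allP L0).
Qed.

End SimpleForms.

(** * Moebius maps acting on finite points *)

Section Action.
Variable R : realType.
Local Notation C := (R[i]).
Implicit Types (x y z w : C) (p : C * C) (L : seq (C * C)) (A B : 'M[C]_2).
Implicit Types (S T : PSL2 R).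

Definition num A z := A 0 0 * z + A 0 1.
Definition den A z := A 1 0 * z + A 1 1.

Definition mat T : 'M[C]_2 := SL2_mx (repr T).

(** The action on the finite part of the sphere, as a partial function: [mx_sends]
    requires the image of [z] to be finite, so that the point at infinity never
    has to be named. *)
Definition mx_sends A z w := (den A z != 0) && (num A z == w * den A z).

Definition sends T z w := mx_sends (mat T) z w.

(** Meaningful only where the denominator does not vanish. *)
Definition act T z := num (mat T) z / den (mat T) z.

Lemma sendsE T z w : sends T z w = (den (mat T) z != 0) && (act T z == w).
Proof.
rewrite /sends /mx_sends /act; case: eqVneq => //= d0.
by rewrite -[in RHS](inj_eq (mulIf d0)) divfK.
Qed.

Lemma sends_fun T z w w' : sends T z w -> sends T z w' -> w = w'.
Proof. by rewrite !sendsE => /andP[_ /eqP <-] /andP[_ /eqP]. Qed.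

Lemma mx2_eq A B : A 0 0 = B 0 0 -> A 0 1 = B 0 1 -> A 1 0 = B 1 0 ->
  A 1 1 = B 1 1 -> A = B.
Proof.
move=> h00 h01 h10 h11; apply/matrixP => i j.
case: i => -[|[|//]] ?; case: j => -[|[|//]] ?;
  [move: h00|move: h01|move: h10|move: h11];
  by congr (A _ _ = B _ _); apply: val_inj.
Qed.

Lemma mulmx2E A B i j : (A *m B) i j = A i 0 * B 0 j + A i 1 * B 1 j.
Proof.
by rewrite !mxE !big_ord_recl big_ord0 addr0; congr (_ + A i _ * B _ j); apply: val_inj.
Qed.

Lemma det2E A : \det A = A 0 0 * A 1 1 - A 0 1 * A 1 0.
Proof.
rewrite (expand_det_row _ 0) !big_ord_recl big_ord0 addr0 /cofactor.
rewrite !det_mx11 !mxE /=.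
have -> : lift ord0 0 = 1 :> 'I_2 by apply: val_inj.
have -> : lift 1 0 = 0 :> 'I_2 by apply: val_inj.
by rewrite expr1 expr0 mul1r mulN1r mulrN.
Qed.

Lemma det_mat T : mat T 0 0 * mat T 1 1 - mat T 0 1 * mat T 1 0 = 1.
Proof. by rewrite -det2E SL2_det. Qed.

Lemma matV T : invmx (mat T) =
  \matrix_(i, j) (if i == 0 then if j == 0 then mat T 1 1 else - mat T 0 1
                  else if j == 0 then - mat T 1 0 else mat T 0 0).
Proof.
set B := (RHS); have dT := det_mat T.
suff E : B *m mat T = 1%:M.
  by rewrite -[RHS]mulmx1 -(mulmxV (SL2_unit (repr T))) mulmxA E mul1mx.
by apply: mx2_eq; rewrite mulmx2E !mxE //= -?dT; ring.
Qed.

Lemma mat_mul S T : mat (S * T)%g = mat S *m mat T \/ mat (S * T)%g = - (mat S *m mat T).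
Proof.
rewrite /mat -{1 3}[S]reprK -{1 3}[T]reprK.
have -> (A B : SL2 R) : (\pi_(PSL2 R) A * \pi_(PSL2 R) B)%g = \pi_(PSL2 R) (SL2_mul A B).
  by rewrite pi_PSL2_mul.
exact: repr_psl.
Qed.

Lemma mx_sendsN A z w : mx_sends (- A) z w = mx_sends A z w.
Proof.
by rewrite /mx_sends /num /den !mxE !mulNr -!opprD oppr_eq0 mulrN eqr_opp.
Qed.

Lemma mx_sends_mul A B z w y : mx_sends B z w -> mx_sends A w y ->
  mx_sends (A *m B) z y.
Proof.
move=> /andP[B0 /eqP Bz] /andP[A0 /eqP Aw].
have numE : num (A *m B) z = num A w * den B z.
  transitivity (A 0 0 * num B z + A 0 1 * den B z).
    by rewrite /num /den !mulmx2E; ring.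
  by rewrite Bz /num; ring.
have denE : den (A *m B) z = den A w * den B z.
  transitivity (A 1 0 * num B z + A 1 1 * den B z).
    by rewrite /num /den !mulmx2E; ring.
  by rewrite Bz /den; ring.
by rewrite /mx_sends numE denE mulf_neq0 //= Aw mulrA.
Qed.

Lemma sends_mul S T z w y : sends T z w -> sends S w y -> sends (S * T)%g z y.
Proof.
rewrite /sends => Tz Sw; have := mx_sends_mul Tz Sw.
by case: (mat_mul S T) => ->; rewrite ?mx_sendsN.
Qed.

Lemma mat_inv T : mat (T^-1)%g = invmx (mat T) \/ mat (T^-1)%g = - invmx (mat T).
Proof.
rewrite /mat -{1 3}[T]reprK.
have -> (A : SL2 R) : ((\pi_(PSL2 R) A)^-1)%g = \pi_(PSL2 R) (SL2_inv A).
  by rewrite pi_PSL2_inv.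
exact: repr_psl.
Qed.

Lemma sends_inv T z w : sends T z w -> sends (T^-1)%g w z.
Proof.
rewrite /sends => /andP[d0 /eqP Tz]; have dT := det_mat T.
suff : mx_sends (invmx (mat T)) w z by case: (mat_inv T) => ->; rewrite ?mx_sendsN.
(* At [w], the denominator of the inverse map is the inverse of [den (mat T) z]. *)
have E : (- mat T 1 0 * w + mat T 0 0) * den (mat T) z = 1.
  transitivity (- mat T 1 0 * (w * den (mat T) z) + mat T 0 0 * den (mat T) z).
    by ring.
  by rewrite -Tz -dT /num /den; ring.
have i0 : den (invmx (mat T)) w != 0.
  rewrite matV /den !mxE /=; apply: contraTneq isT => E0.
  by move: E; rewrite E0 mul0r => /esym/eqP; rewrite oner_eq0.
rewrite /mx_sends i0 /=; apply/eqP; apply: (mulIf d0).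
rewrite matV {1}/num {2}/den !mxE /= -[RHS]mulrA E mulr1.
transitivity (mat T 1 1 * (w * den (mat T) z) - mat T 0 1 * den (mat T) z).
  by ring.
by rewrite -Tz -[RHS]mulr1 -dT /num /den; ring.
Qed.

Lemma sends_inj T z z' w : sends T z w -> sends T z' w -> z = z'.
Proof. by move=> /sends_inv h /sends_inv; apply: sends_fun. Qed.

Lemma mat1 T : (mat T = 1%:M \/ mat T = - 1%:M) <-> T = 1%g.
Proof.
have -> : (T = 1%g) <-> psl_eqv (repr T) (SL2_one R).
  rewrite -{1}[T]reprK -[1%g]/(\pi_(PSL2 R) (SL2_one R)).
  by split => [/eqmodP|?]; last apply/eqmodP.
rewrite /psl_eqv /= /mat; split => [[]->|/orP[]/eqP]; rewrite ?eqxx ?orbT //.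
  by left.
by right.
Qed.

Lemma sends1 z : sends 1%g z z.
Proof.
rewrite /sends.
have h : mx_sends 1%:M z z.
  rewrite /mx_sends /num /den !mxE /=.
  by rewrite mul0r add0r oner_neq0 mul1r addr0 mulr1 eqxx.
by case: ((mat1 1%g).2 erefl) => ->; rewrite ?mx_sendsN.
Qed.

(** For the matrix with rows [a, b] and [c, d], the equation
    [(a * z + b) / (c * z + d) = z] reads [c * z ^+ 2 + (d - a) * z - b = 0]. *)
Definition fixed_poly T : {poly C} :=
  Poly [:: - mat T 0 1; mat T 1 1 - mat T 0 0; mat T 1 0].

Lemma fixed_polyP T z : sends T z z -> root (fixed_poly T) z.
Proof.
move=> /andP[_ /eqP]; rewrite /num /den rootE horner_Poly /= => /eqP.
rewrite -subr_eq0 -oppr_eq0 => /eqP E; apply/eqP; rewrite -[RHS]E; ring.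
Qed.

(** If the three coefficients vanish, the matrix is scalar of determinant 1, hence
    [1] or [-1]. *)
Lemma fixed_poly_eq0 T : fixed_poly T = 0 -> T = 1%g.
Proof.
move=> q0; have dT := det_mat T.
have coef i : (fixed_poly T)`_i = 0 by rewrite q0 coef0.
have := coef 2; have := coef 1; have := coef 0; rewrite !coef_Poly /=.
move=> /eqP; rewrite oppr_eq0 => /eqP b0 /eqP; rewrite subr_eq0 => /eqP da c0.
move: dT; rewrite b0 da mul0r subr0 -expr2 => /eqP; rewrite sqrf_eq1.
move=> a1; apply/mat1.
by case/orP: a1 => /eqP a1; [left|right]; apply: mx2_eq;
  rewrite !mxE /= ?b0 ?c0 ?da ?a1 ?oppr0.
Qed.

(** [fixed_poly T] has degree at most 2, so three roots force it to vanish. *)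
Lemma sends_fixed3 T z0 z1 z2 : uniq [:: z0; z1; z2] ->
  sends T z0 z0 -> sends T z1 z1 -> sends T z2 z2 -> T = 1%g.
Proof.
move=> uz h0 h1 h2; apply: fixed_poly_eq0; apply/eqP/negPn/negP => q0.
have := max_poly_roots q0 _ uz; rewrite /= !fixed_polyP //= => /(_ isT).
by rewrite ltnNge size_Poly.
Qed.

(** Apply [pullback_pole] to [T^-1]: the preimage of [p.1] is [act T p.1], and the
    poles at the preimage of infinity add up to a multiple of the sum of the
    residues, which is 0.  The poles that [T] moves to infinity disappear from
    the affine expression. *)
Lemma pushforward_simple_form T L : \sum_(p <- L) p.2 = 0 ->
  pushforward T (simple_form L) =
  simple_form [seq (act T p.1, p.2) | p <- L & den (mat T) p.1 != 0].
Proof.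
move=> sumL; rewrite -{1}[T]reprK pushforward_pi -/(mat T).
have -> : moebius (invmx (mat T)) =
    (lin (mat T 1 1) (- mat T 0 1))%:F / (lin (- mat T 1 0) (mat T 0 0))%:F.
  by rewrite matV /moebius !mxE.
have nz : mat T 1 1 * mat T 0 0 - - mat T 0 1 * - mat T 1 0 != 0.
  by rewrite mulrNN mulrC det_mat oner_neq0.
rewrite pullback_simple_form; last exact: nonconstant_lin.
have poleE p : pullback ((lin (mat T 1 1) (- mat T 0 1))%:F /
                         (lin (- mat T 1 0) (mat T 0 0))%:F) (pole p) =
   (if den (mat T) p.1 != 0 then pole (act T p.1, p.2) else 0)
   - p.2%:P%:F * ((- mat T 1 0)%:P%:F / (lin (- mat T 1 0) (mat T 0 0))%:F).
  rewrite pullback_pole // mulrBr; congr (_ - _).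
  have -> : mat T 1 1 - p.1 * - mat T 1 0 = den (mat T) p.1 by rewrite /den; ring.
  have -> : - mat T 0 1 - p.1 * mat T 0 0 = - num (mat T) p.1 by rewrite /num; ring.
  case: eqP => [->|/eqP d0] /=; first by rewrite mul0r mulr0.
  rewrite /pole /=; congr (_ * _); rewrite -[RHS]div1r.
  apply/eqP; rewrite eqr_div ?tofrac_eq0 ?polyXsubC_eq0 //; last first.
    by rewrite lin_eq0 (negPf d0).
  rewrite mul1r -tofracM tofrac_eq mulrBr -polyCM /act mulrCA divff // mulr1.
  by rewrite /lin mul_polyC rmorphN.
rewrite (eq_bigr _ (fun p _ => poleE p)) sumrB -mulr_suml.
have -> : \sum_(p <- L) p.2%:P%:F = (\sum_(p <- L) p.2)%:P%:F :> {fraction {poly C}}.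
  by rewrite !rmorph_sum.
rewrite sumL !rmorph0 mul0r subr0.
by rewrite /simple_form big_map big_filter [RHS]big_mkcond.
Qed.

End Action.

(** * Generic points *)

(** The product of the nonzero polynomials in [ps] has finitely many roots, and
    the integers are infinitely many. *)
Lemma exists_nonroot (K : numDomainType) (ps : seq {poly K}) :
  exists z, {in ps, forall q, q != 0 -> ~~ root q z}.
Proof.
pose Q := \prod_(q <- ps | q != 0) q.
have Q0 : Q != 0.
  rewrite /Q; apply: (big_ind (fun q => q != 0)) => [|p q p0 q0|//].
    exact: oner_neq0.
  exact: mulf_neq0.
pose rs : seq K := [seq i%:R | i <- iota 0 (size Q)].
have : ~~ all (root Q) rs.
  apply: contraTN (leqnn (size Q)) => rootQ; rewrite -ltnNge.
  rewrite -[X in (X < _)%N](size_iota 0) -(size_map (fun i => i%:R : K)).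
  apply: max_poly_roots => //.
  rewrite map_inj_uniq ?iota_uniq // => i j /eqP.
  by rewrite eqr_nat => /eqP.
move=> /allPn[z _ Qz]; exists z => q qps q0.
by apply: contraNN Qz; rewrite /Q (big_rem q) //= q0 rootM => ->.
Qed.

Section Generic.
Variable R : realType.
Local Notation C := (R[i]).
Implicit Types (z y : C) (s : seq (PSL2 R)) (T : PSL2 R).

Lemma sends_root T z y : sends T z y ->
  root (lin (mat T 0 0 - y * mat T 1 0) (mat T 0 1 - y * mat T 1 1)) z.
Proof.
move=> /andP[_ /eqP]; rewrite /num /den rootE horner_lin => E.
apply/eqP; transitivity (mat T 0 0 * z + mat T 0 1 - y * (mat T 1 0 * z + mat T 1 1)).
  by ring.
by rewrite E subrr.
Qed.

(** Each condition excludes the roots of one nonzero polynomial: the denominator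
    of [T], [fixed_poly T], and [num - y * den]. *)
Lemma exists_generic s (ys : seq C) (ps : seq {poly C}) : exists z,
  [/\ {in s, forall T, den (mat T) z != 0},
      {in s, forall T, T != 1%g -> ~~ sends T z z},
      {in s & ys, forall T y, ~~ sends T z y} &
      {in ps, forall q, q != 0 -> ~~ root q z}].
Proof.
pose f T y := lin (mat T 0 0 - y * mat T 1 0) (mat T 0 1 - y * mat T 1 1).
have detf T y : (mat T 0 0 - y * mat T 1 0) * mat T 1 1
                - (mat T 0 1 - y * mat T 1 1) * mat T 1 0 != 0.
  set e := (X in X != 0); have -> : e = 1 by rewrite -(det_mat T) /e; ring.
  exact: oner_neq0.
pose d T := lin (mat T 1 0) (mat T 1 1).
have [z zP] := exists_nonroot
  ([seq d T | T <- s] ++ [seq fixed_poly T | T <- s]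
   ++ [seq f T y | T <- s, y <- ys] ++ ps).
exists z; split=> [T Ts|T Ts T1|T y Ts yys|q qps].
- have := zP (d T); rewrite mem_cat (map_f d Ts).
  by move=> /(_ isT (lin_neq0r (detf T 0))); rewrite rootE horner_lin.
- apply/negP => /fixed_polyP; apply/negP; apply: zP.
    by rewrite !mem_cat (map_f (@fixed_poly R) Ts) orbT.
  by apply: contra_neq T1; apply: fixed_poly_eq0.
- apply/negP => /sends_root; apply/negP; apply: zP.
    by rewrite !mem_cat (allpairs_f f Ts yys) !orbT.
  exact: lin_neq0l (detf T y).
- by apply: zP; rewrite !mem_cat qps !orbT.
Qed.

Lemma sends_act T z : den (mat T) z != 0 -> sends T z (act T z).
Proof. by move=> d0; rewrite sendsE d0 eqxx. Qed.

(** For each triple in [bs] at most one [T] sends it to [(z0, z1, z2)]: two such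
    maps differ by one with three fixed points.  Collecting one for each triple,
    if there is any, gives [Ts]. *)
Lemma transporters_finite (bs : seq (C * C * C)) (z0 z1 z2 : C) :
    {in bs, forall b, uniq [:: b.1.1; b.1.2; b.2]} ->
  exists Ts : seq (PSL2 R), forall T, {in bs, forall b,
    sends T b.1.1 z0 -> sends T b.1.2 z1 -> sends T b.2 z2 -> T \in Ts}.
Proof.
move=> bsP; pose P b : set (PSL2 R) :=
  [set T | [/\ sends T b.1.1 z0, sends T b.1.2 z1 & sends T b.2 z2]].
exists [seq xget 1%g (P b) | b <- bs] => T b bb h0 h1 h2.
apply/mapP; exists b => //.
have [k0 k1 k2] : P b (xget 1%g (P b)) by apply: (xgetPex 1%g); exists T.
set S := xget _ _ in k0 k1 k2 *.
suff ST : (S^-1 * T = 1)%g by rewrite -[T]mul1g -(mulgV S) -mulgA ST mulg1.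
by apply: (sends_fixed3 (bsP b bb)); [move: h0|move: h1|move: h2] => h;
  apply: (sends_mul h); apply: sends_inv.
Qed.

End Generic.

Lemma uniq_map_inj (T U : eqType) (f : T -> U) (xs : seq T) :
  uniq (map f xs) -> {in xs &, injective f}.
Proof.
elim: xs => // x xs IH /= /andP[fx uxs] y z; rewrite !inE.
move=> /predU1P[->|yxs] /predU1P[->|zxs] // E; last exact: IH.
  by move: fx; rewrite E map_f.
by move: fx; rewrite -E map_f.
Qed.

Section FreePoints.
Variable R : realType.
Local Notation C := (R[i]).
Variable s : seq (PSL2 R).
Implicit Types (g h T : PSL2 R) (y z : C) (zs : seq C).
Hypothesis s_group : group_closed (mem s).

(** The orbits of the points of [zs] under [s] avoid infinity, are regular and are
    pairwise disjoint. *)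
Definition free_points zs :=
  [/\ uniq zs, {in s & zs, forall g z, den (mat g) z != 0} &
      {in s, forall g, {in zs &, forall y z, sends g y z -> g = 1%g /\ y = z}}].

Let s1 : 1%g \in s := s_group.1.
Let sV g : g \in s -> (g^-1)%g \in s.
Proof. exact: (group_closedV s_group). Qed.
Let sM g h : g \in s -> h \in s -> (g * h)%g \in s.
Proof. exact: (group_closedM s_group). Qed.

Lemma free_points_sends zs g z : free_points zs -> g \in s -> z \in zs ->
  sends g z (act g z).
Proof. by move=> [_ fin _] gs zzs; apply/sends_act/fin. Qed.

Lemma free_points_act_inj zs g h y z : free_points zs -> g \in s -> h \in s ->
  y \in zs -> z \in zs -> act g y = act h z -> g = h /\ y = z.
Proof.
move=> zsF gs hs yzs zzs E; have [_ _ free] := zsF.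
have := free_points_sends zsF gs yzs; rewrite E => gy.
have hz := sends_inv (free_points_sends zsF hs zzs).
have [|hg ->] := free _ _ _ _ yzs zzs (sends_mul gy hz).
  by apply: sM => //; apply: sV.
by split=> //; rewrite -[LHS]mul1g -(mulgV h) -mulgA hg mulg1.
Qed.

Lemma free_points_actM zs T g z : free_points zs -> T \in s -> g \in s ->
  z \in zs -> den (mat T) (act g z) != 0 /\ act T (act g z) = act (T * g)%g z.
Proof.
move=> zsF Ts gs zzs.
have := sends_mul (sends_inv (free_points_sends zsF gs zzs))
                  (free_points_sends zsF (sM Ts gs) zzs).
by rewrite -mulgA mulgV mulg1 sendsE => /andP[? /eqP].
Qed.

(** A generic point, not sent to [zs] by any element of [s], can be added; since
    [s] is closed under inverses, no point of [zs] is sent to it either. *)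
Lemma exists_free_cons zs (ps : seq {poly C}) : free_points zs ->
  exists2 z, free_points (z :: zs) & {in ps, forall q, q != 0 -> ~~ root q z}.
Proof.
move=> [uzs fin free]; have [z [d0 nfix nsend nroot]] := exists_generic s zs ps.
exists z => //; split.
- rewrite /= uzs andbT; apply/negP => zzs.
  by have := nsend _ _ s1 zzs; rewrite sends1.
- by move=> g y gs; rewrite inE => /predU1P[->|yzs]; [apply: d0|apply: fin].
move=> g gs x y; rewrite !inE => /predU1P[->|xzs] /predU1P[->|yzs] h.
- by split=> //; apply: contraTeq h; apply: nfix.
- by have := nsend _ _ gs yzs; rewrite h.
- by have := nsend _ _ (sV gs) xzs; rewrite sends_inv.
- exact: free.
Qed.

(** Three free points leave finitely many candidates [T] for preserving the
    orbit of each point; the fourth one is taken outside the fixed points of the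
    maps [T * g] other than the identity, with [g] in [s], and this excludes the
    candidates outside [s]. *)
Lemma exists_rigid_points : exists zs, [/\ size zs = 4%N, free_points zs &
  forall T, {in zs, forall z, exists2 g, g \in s & sends T (act g z) z} ->
    T \in s].
Proof.
have F0 : free_points [::] by split.
have [z0 F1 _] := exists_free_cons [::] F0.
have [z1 F2 _] := exists_free_cons [::] F1.
have [z2 F3 _] := exists_free_cons [::] F2.
pose triple (gh : PSL2 R * PSL2 R) k := (act gh.1 z0, act gh.2 z1, act k z2).
pose ts := [seq triple gh k | gh <- [seq (g, h) | g <- s, h <- s], k <- s].
have ts_uniq : {in ts, forall t, uniq [:: t.1.1; t.1.2; t.2]}.
  have [/= /and3P[]] := F3; rewrite !inE negb_or => /andP[z21 z20] z10 _ _ _.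
  have neq y z g h : z \in [:: z2; z1; z0] -> y \in [:: z2; z1; z0] ->
      z != y -> g \in s -> h \in s -> act g y != act h z.
    move=> zF yF zy gs hs; apply: contra_neq zy => E.
    by have [_ ->] := free_points_act_inj F3 gs hs yF zF E.
  move=> _ /allpairsP[[_ k] /= [/allpairsP[[g h] /= [gs hs ->]] ks ->]] /=.
  by rewrite !inE negb_or !neq ?inE ?eqxx ?orbT.
(* The finitely many maps sending an element of each of the first three orbits
   to the corresponding base point. *)
have [Ts TsP] := transporters_finite z0 z1 z2 ts_uniq.
have [z3 F4 r3] :=
  exists_free_cons [seq fixed_poly (T * g)%g | T <- Ts, g <- s] F3.
exists [:: z3; z2; z1; z0]; split=> // T TP.
have [|g0 g0s h0] := TP z0; first by rewrite !inE eqxx !orbT.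
have [|g1 g1s h1] := TP z1; first by rewrite !inE eqxx !orbT.
have [|g2 g2s h2] := TP z2; first by rewrite !inE eqxx !orbT.
have [|g3 g3s h3] := TP z3; first by rewrite !inE eqxx.
have TTs : T \in Ts.
  apply: (TsP _ (triple (g0, g1) g2)) => //.
  by apply/allpairs_f/g2s; apply: allpairs_f.
have fix3 : sends (T * g3)%g z3 z3.
  by apply: (sends_mul _ h3); apply: (free_points_sends F4); rewrite ?inE ?eqxx.
have : (T * g3)%g = 1%g.
  apply: fixed_poly_eq0; apply/eqP; apply: contraTT (fixed_polyP fix3).
  by apply: r3; apply: allpairs_f.
by move=> /(canRL (mulgK g3)); rewrite mul1g => ->; apply: sV.
Qed.

End FreePoints.

(** * The form carried by the orbits of weighted points *)

Section OrbitForms.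
Variable R : realType.
Local Notation C := (R[i]).
Variables (s : seq (PSL2 R)) (bs : seq (C * C)).
Implicit Types (g h T : PSL2 R) (p q : C * C).

Hypothesis s_uniq : uniq s.
Hypothesis s_group : group_closed (mem s).
Hypothesis bs_free : free_points s (unzip1 bs).
Hypothesis bs_residues : uniq (unzip2 bs).
Hypothesis bs_sum : \sum_(q <- bs) q.2 = 0.

Definition orbit_poles : seq (C * C) := [seq (act g q.1, q.2) | g <- s, q <- bs].

Let s1 : 1%g \in s := s_group.1.
Let sV g : g \in s -> (g^-1)%g \in s.
Proof. exact: (group_closedV s_group). Qed.
Let sM g h : g \in s -> h \in s -> (g * h)%g \in s.
Proof. exact: (group_closedM s_group). Qed.
Let fst_bs q : q \in bs -> q.1 \in unzip1 bs.
Proof. exact: map_f. Qed.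

Lemma uniq_orbit_poles : uniq (unzip1 orbit_poles).
Proof.
rewrite /orbit_poles /unzip1 map_allpairs /=; apply: allpairs_uniq => //.
  exact: map_uniq bs_residues.
move=> [g q] [h q'] /allpairsPdep[g1 [q1 [g1s q1bs [-> ->]]]].
move=> /allpairsPdep[h1 [q1' [h1s q1'bs [-> ->]]]] /=.
move=> /(free_points_act_inj s_group bs_free g1s h1s (fst_bs q1bs) (fst_bs q1'bs)).
have [uq _ _] := bs_free.
by move=> [-> /(uniq_map_inj uq q1bs q1'bs) ->].
Qed.

Lemma sum_orbit_poles : \sum_(p <- orbit_poles) p.2 = 0.
Proof. by rewrite big_allpairs_dep /= big1 // => g _; rewrite bs_sum. Qed.

Lemma orbit_form_invariant T : T \in s ->
  pushforward T (simple_form orbit_poles) = simple_form orbit_poles.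
Proof.
move=> Ts; rewrite pushforward_simple_form; last exact: sum_orbit_poles.
have -> : [seq p <- orbit_poles | den (mat T) p.1 != 0] = orbit_poles.
  apply/all_filterP/allP => _ /allpairsP[[g q] /= [gs qbs ->]] /=.
  by have [] := free_points_actM s_group bs_free Ts gs (fst_bs qbs).
rewrite /simple_form big_map !big_allpairs_dep /=.
have perm_s : perm_eq [seq (T * g)%g | g <- s] s.
  have inj_T : injective (fun g => (T * g)%g) by exact: mulgI.
  apply: uniq_perm => //; first by rewrite map_inj_uniq.
  move=> g; apply/mapP/idP => [[h hs ->]|gs]; first exact: sM.
  exists (T^-1 * g)%g; first by apply: sM => //; apply: sV.
  by rewrite mulgA mulgV mul1g.
rewrite -[RHS](perm_big _ perm_s) big_map /=.
apply: eq_big_seq => g gs; apply: eq_big_seq => q qbs.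
by have [_ ->] := free_points_actM s_group bs_free Ts gs (fst_bs qbs).
Qed.

(** The form has residue [q.2] at [q.1].  By invariance so has its push-forward,
    whose poles are the [act T p.1], with the residue of [p].  Hence [T] sends
    some pole of residue [q.2] to [q.1], and distinct residues identify the orbit
    of this pole as that of [q]. *)
Lemma orbit_form_stabilizer T q : q \in bs -> q.2 != 0 ->
    pushforward T (simple_form orbit_poles) = simple_form orbit_poles ->
  exists2 g, g \in s & sends T (act g q.1) q.1.
Proof.
move=> qbs q0; rewrite pushforward_simple_form; last exact: sum_orbit_poles.
set L' := map _ _ => eq_form.
(* The base point is the element of its orbit given by the identity. *)
have qL : q \in orbit_poles.
  apply/allpairsP; exists (1%g, q); split => //=.
  rewrite -(sends_fun (sends1 q.1) (free_points_sends bs_free s1 (fst_bs qbs))).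
  exact: surjective_pairing.
have uL' : uniq (unzip1 L').
  rewrite /unzip1 -map_comp map_inj_in_uniq.
    exact/filter_uniq/(map_uniq uniq_orbit_poles).
  move=> x y; rewrite !mem_filter => /andP[dx xL] /andP[dy yL] /= E.
  have := sends_act dx; rewrite E => /sends_inj/(_ (sends_act dy)) E1.
  by apply: (uniq_map_inj uniq_orbit_poles xL yL).
have resL' : residue_at L' q.1 = q.2.
  have := local_form_finite L' q.1; rewrite eq_form => h.
  have := simple_pole_with_uniq h (local_form_finite _ _).
  by rewrite (residue_at_in uniq_orbit_poles qL).
have : q.1 \in unzip1 L'.
  by apply: contraR q0 => /residue_at_out E; rewrite -resL' E.
move=> /mapP[p pL' q1E].
have p2E : p.2 = q.2 by rewrite -resL' q1E residue_at_in.
move: pL' q1E p2E => /mapP[p0]; rewrite mem_filter => /andP[d0].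
move=> /allpairsP[[g q'] /= [gs q'bs p0E]] -> /= q1E p2E.
have q'E : q' = q.
  by apply: (uniq_map_inj bs_residues q'bs qbs); rewrite -p2E p0E.
by exists g => //; have := sends_act d0; rewrite -q1E p0E q'E.
Qed.

End OrbitForms.

Theorem proposition3p3 (R : realType) (G : {pred PSL2 R})
    (G_group : group_closed G) (G_finite : finite_set [set` G]) :
  exists (s : nat) (w : ratform R),
    [/\ (2 <= s)%N, isochronous_forms s w & isotropy w = [set` G]].
Proof.
have [s0 Gs0] := (finite_seqP _).1 G_finite.
pose s := undup s0.
have sG : s =i G.
  move=> g; rewrite mem_undup; apply/idP/idP => gs.
    by have : [set` s0] g by []; rewrite -Gs0.
  by have : [set` G] g by []; rewrite Gs0.
have s_group : group_closed (mem s).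
  have [G1 GB] := G_group; split=> [|g h]; rewrite !sG //; exact: GB.
have [zs [sz zsF zsP]] := exists_rigid_points s_group.
(* Four distinct nonzero weights of sum 0, one for each orbit. *)
pose ms : seq int := [:: 1; 2; 3; - 6].
pose cs : seq R[i] := [seq 0 +i* m%:~R | m <- ms].
have szc : size zs = size cs by rewrite sz.
pose bs := zip zs cs.
have bs1 : unzip1 bs = zs by rewrite unzip1_zip ?szc.
have bs2 : unzip2 bs = cs by rewrite unzip2_zip ?szc.
have bsF : free_points s (unzip1 bs) by rewrite bs1.
have bs_sum : \sum_(q <- bs) q.2 = 0.
  rewrite -(big_map snd predT id) -/(unzip2 bs) bs2 !big_cons big_nil /=.
  by apply/eqP; rewrite eq_complex /=; apply/andP; split; apply/eqP; ring.
have cs_uniq : uniq (unzip2 bs).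
  by rewrite bs2 map_inj_uniq // => m n [] /intr_inj.
have cs0 : {in unzip2 bs, forall c, c != 0}.
  rewrite bs2 => _ /mapP[m mms ->]; rewrite eq_complex /= eqxx intr_eq0.
  by apply: contraTneq mms => ->.
have csi : {in unzip2 bs, forall c, complex.Re c == 0}.
  by rewrite bs2 => _ /mapP[m _ ->] /=.
have inbs p : p \in orbit_poles s bs -> p.2 \in unzip2 bs.
  by move=> /allpairsP[[g q] [_ qbs ->]]; exact: (map_f snd qbs).
exists (size (orbit_poles s bs)), (simple_form (orbit_poles s bs)); split.
- rewrite size_allpairs -(size_map fst bs) -/(unzip1 bs) bs1 sz.
  have : (index 1%g s < size s)%N by rewrite index_mem; exact: s_group.1.
  by case: (size s).
- apply: simple_form_isochronous.
  + exact: (uniq_orbit_poles (undup_uniq s0) s_group bsF cs_uniq).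
  + by apply/allP => p /inbs; apply: cs0.
  + exact: (sum_orbit_poles _ bs_sum).
  + by apply/allP => p /inbs; apply: csi.
apply/seteqP; split=> T /= HT.
  rewrite -sG; apply: zsP => z; rewrite -bs1 => /mapP[q qbs ->].
  apply: (orbit_form_stabilizer (undup_uniq _) s_group bsF cs_uniq bs_sum qbs _ HT).
  by apply: cs0; apply: map_f.
by apply: orbit_form_invariant => //; [exact: undup_uniq|rewrite sG].
Qed.
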